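(* For every $\varepsilon>0$ there exists an FPT (parameterized by $k$) $(3+\varepsilon)$-approximation algorithm for the $k$-min-sum-radii problem with uniform lower bounds.
   Context: An instance consists of a finite point set $P$, a metric $d$ on $P$, $k\in\mathbb{N}$ and a lower bound $\ell\in\mathbb{N}$. A solution consists of at most $k$ centers $\mathscr{C}\subseteq P$ and an assignment $\sigma\colon P\to\mathscr{C}$ such that every cluster $\sigma^{-1}(c)$ contains at least $\ell$ points; the radius of $\sigma^{-1}(c)$ is $\max_{p\in\sigma^{-1}(c)}d(p,c)$, and the objective is to minimize the sum of cluster radii. FPT means running time $f(k,\varepsilon)\cdot\mathrm{poly}(|P|)$. *)

(* Defs.v *)
From mathcomp Require Import all_boot all_order all_algebra.
From mathcomp Require Import reals.
Set Implicit Arguments.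
Unset Strict Implicit.
Unset Printing Implicit Defensive.
Import Order.TTheory GRing.Theory Num.Theory.
Local Open Scope ring_scope.

Record is_metric (R : realType) (P : Type) (d : P -> P -> R) : Prop := IsMetric {
  metric_ge0 : forall x y, 0 <= d x y;
  metric_eq0 : forall x y, d x y = 0 <-> x = y;
  metric_sym : forall x y, d x y = d y x;
  metric_triangle : forall x y z, d x z <= d x y + d y z
}.

Record instance (R : realType) := Instance {
  point : finType;
  dist : point -> point -> R;
  dist_metric : is_metric dist;
  budget : nat;
  lower_bound : nat
}.

Record candidate (P : finType) := Candidate {
  centers : {set P};
  assign : P -> P
}.

Section Problem.
Variables (R : realType) (I : instance R).
Implicit Type s : candidate (point I).

Definition cluster s (c : point I) : {set point I} := [set p | assign s p == c].

Definition feasible s : Prop :=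
  [/\ (#|centers s| <= budget I)%N,
      (forall p, assign s p \in centers s)
    & (forall c, c \in centers s -> (lower_bound I <= #|cluster s c|)%N)].

(* Distances are nonnegative, so starting the maximum at 0 only matters for an
   empty cluster (possible when the lower bound is 0), which gets radius 0. *)
Definition radius s (c : point I) : R :=
  \big[Num.max/0]_(p in cluster s c) dist p c.

Definition cost s : R := \sum_(c in centers s) radius s c.

Definition optimal s : Prop :=
  feasible s /\ forall s', feasible s' -> cost s <= cost s'.

End Problem.

(* Model of computation: a real RAM, presented as a while-language.
   There are two separate memories, one of natural numbers and one of reals,
   each organised as finitely many (statically named) unbounded arrays with
   indirect addressing; a scalar variable is cell 0 of an array.
   - Natural numbers only have +, truncated - and <=, so that each operation
     adds at most one bit to their size (unit-cost multiplication would not be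
     a realistic cost measure here).
   - Reals have the field operations and <=, with no rounding and no conversion
     to naturals; literals are rational, so that a program cannot hide an
     infinite amount of information in a real constant.
   - [RDist e1 e2] queries the distance between two points given by their
     numbers. *)

Inductive nexp : Type :=
  | NLit of nat
  | NGet of nat & nexp
  | NAdd of nexp & nexp
  | NSub of nexp & nexp.

Inductive rexp : Type :=
  | RLit of rat
  | RGet of nat & nexp
  | RDist of nexp & nexp
  | RAdd of rexp & rexp
  | RSub of rexp & rexp
  | RMul of rexp & rexp
  | RDiv of rexp & rexp.

Inductive bexp : Type :=
  | BNle of nexp & nexp
  | BRle of rexp & rexp
  | BNot of bexp
  | BAnd of bexp & bexp.

Inductive program : Type :=
  | Skip
  | NSet of nat & nexp & nexp
  | RSet of nat & nexp & rexp
  | Seq of program & program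
  | If of bexp & program & program
  | While of bexp & program.

Fixpoint nexp_cost (e : nexp) : nat :=
  match e with
  | NLit _ => 1
  | NGet _ e1 => (nexp_cost e1).+1
  | NAdd e1 e2 | NSub e1 e2 => (nexp_cost e1 + nexp_cost e2).+1
  end.

Fixpoint rexp_cost (e : rexp) : nat :=
  match e with
  | RLit _ => 1
  | RGet _ e1 => (nexp_cost e1).+1
  | RDist e1 e2 => (nexp_cost e1 + nexp_cost e2).+1
  | RAdd e1 e2 | RSub e1 e2 | RMul e1 e2 | RDiv e1 e2 =>
      (rexp_cost e1 + rexp_cost e2).+1
  end.

Fixpoint bexp_cost (e : bexp) : nat :=
  match e with
  | BNle e1 e2 => (nexp_cost e1 + nexp_cost e2).+1
  | BRle e1 e2 => (rexp_cost e1 + rexp_cost e2).+1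
  | BNot e1 => (bexp_cost e1).+1
  | BAnd e1 e2 => (bexp_cost e1 + bexp_cost e2).+1
  end.

Definition update (T : Type) (m : nat -> nat -> T) (a i : nat) (v : T) :
    nat -> nat -> T :=
  fun a' i' => if (a' == a) && (i' == i) then v else m a' i'.

Record state (R : realType) := State {
  nmem : nat -> nat -> nat;
  rmem : nat -> nat -> R
}.

Section Semantics.
Variables (R : realType) (D : nat -> nat -> R).
Implicit Type s : state R.

Fixpoint neval s (e : nexp) : nat :=
  match e with
  | NLit n => n
  | NGet a e1 => nmem s a (neval s e1)
  | NAdd e1 e2 => (neval s e1 + neval s e2)%N
  | NSub e1 e2 => (neval s e1 - neval s e2)%N
  end.

Fixpoint reval s (e : rexp) : R :=
  match e with
  | RLit q => ratr q
  | RGet a e1 => rmem s a (neval s e1)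
  | RDist e1 e2 => D (neval s e1) (neval s e2)
  | RAdd e1 e2 => reval s e1 + reval s e2
  | RSub e1 e2 => reval s e1 - reval s e2
  | RMul e1 e2 => reval s e1 * reval s e2
  | RDiv e1 e2 => reval s e1 / reval s e2
  end.

Fixpoint beval s (e : bexp) : bool :=
  match e with
  | BNle e1 e2 => (neval s e1 <= neval s e2)%N
  | BRle e1 e2 => reval s e1 <= reval s e2
  | BNot e1 => ~~ beval s e1
  | BAnd e1 e2 => beval s e1 && beval s e2
  end.

(* [exec c s t s'] : started in [s], the program [c] halts in [s'] after
   exactly [t] elementary operations. *)
Inductive exec : program -> state R -> nat -> state R -> Prop :=
  | ExecSkip s : exec Skip s 1 s
  | ExecNSet s a e1 e2 :
      exec (NSet a e1 e2) s (nexp_cost e1 + nexp_cost e2).+1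
        (State (update (nmem s) a (neval s e1) (neval s e2)) (rmem s))
  | ExecRSet s a e1 e2 :
      exec (RSet a e1 e2) s (nexp_cost e1 + rexp_cost e2).+1
        (State (nmem s) (update (rmem s) a (neval s e1) (reval s e2)))
  | ExecSeq s s1 s2 c1 c2 t1 t2 :
      exec c1 s t1 s1 -> exec c2 s1 t2 s2 ->
      exec (Seq c1 c2) s (t1 + t2)%N s2
  | ExecIf s s1 b c1 c2 t :
      exec (if beval s b then c1 else c2) s t s1 ->
      exec (If b c1 c2) s (bexp_cost b + t).+1 s1
  | ExecWhileDone s b c :
      ~~ beval s b -> exec (While b c) s (bexp_cost b).+1 s
  | ExecWhileStep s s1 s2 b c t1 t2 :
      beval s b -> exec c s t1 s1 -> exec (While b c) s1 t2 s2 ->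
      exec (While b c) s (bexp_cost b + t1 + t2).+1 s2.

End Semantics.

Section InputOutput.
Variables (R : realType) (I : instance R).

(* The points are numbered 0, ..., |P| - 1 by [enum_rank]. *)
Definition dist_query (i j : nat) : R :=
  match (insub i : option 'I_#|point I|), (insub j : option 'I_#|point I|) with
  | Some x, Some y => dist (enum_val x) (enum_val y)
  | _, _ => 0
  end.

(* Input: cells 0, 1, 2 of array 0 hold |P|, k and l; all else is zero. *)
Definition input_state : state R :=
  State (fun a i => if a == 0%N
                    then nth 0%N [:: #|point I|; budget I; lower_bound I] i
                    else 0%N)
        (fun _ _ => 0).

(* Output: array 1 maps (the number of) each point to its center, and array 2
   holds a nonzero flag exactly at the centers. *)
Definition outputs (s : state R) (x : candidate (point I)) : Prop :=
  forall p : point I,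
    nmem s 1 (enum_rank p) = enum_rank (assign x p) :> nat /\
    (p \in centers x) = (nmem s 2 (enum_rank p) != 0%N).

(* [A] halts on [I] within [T] steps and, if [I] has an optimal solution
   (equivalently, any feasible one), outputs a feasible solution of cost at
   most [alpha] times the optimum. *)
Definition approximates_within (A : program) (alpha : R) (T : nat) : Prop :=
  exists (t : nat) (s : state R),
    [/\ exec dist_query A input_state t s,
        (t <= T)%N
      & forall opt : candidate (point I), optimal opt ->
          exists x : candidate (point I),
            [/\ outputs s x, feasible x & cost x <= alpha * cost opt]].

End InputOutput.

(* Main.v *)
Require Import Defs.
From mathcomp Require Import all_boot all_order all_algebra.
From mathcomp Require Import reals.
From mathcomp Require Import zify lra.
Set Implicit Arguments.
Unset Strict Implicit.
Unset Printing Implicit Defensive.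
Import Order.TTheory GRing.Theory Num.Theory.
Local Open Scope ring_scope.

(* Guess the largest radius [rmax] of an optimal solution, which is one of the
   |P|^2 distances, and put [u = rmax / k].  Then make k steps.  In each step,
   take an uncovered point [p] of some optimal cluster [C] of radius [r] and
   guess the least multiple of [u] that is at least [2 r]; there are at most
   [2 k + 1] candidates.  If some point of [C] already lies in a ball, guess the
   center of that ball and grow the ball by this amount; otherwise open a ball
   of this radius around [p].  In both cases [C] is now covered.  A point
   belongs to the ball that covers it first.  A ball is opened only when the
   whole of [C] is uncovered, so it immediately owns at least |C| >= l points,
   and it never loses any.  Every step swallows a new optimal cluster, so after
   k steps everything is covered, at cost at most
   [sum (2 r + u) <= 2 OPT + rmax <= 3 OPT].  There are |P|^2 times a function of
   k guesses, and the best valid outcome is kept. *)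

(** * Structured programs *)

(** Loops are counted only, so termination and a step bound can be derived once and for all from the
    syntax. *)
Inductive stm : Type :=
  | SN of nat & nexp & nexp
  | SR of nat & nexp & rexp
  | SSeq of stm & stm
  | SWhen of bexp & stm
  | SFor of nat & nexp & stm.

Definition nvar (a : nat) : nexp := NGet a (NLit 0).

Fixpoint compile (c : stm) : program :=
  match c with
  | SN a e1 e2 => NSet a e1 e2
  | SR a e1 e2 => RSet a e1 e2
  | SSeq c1 c2 => Seq (compile c1) (compile c2)
  | SWhen b c1 => If b (compile c1) Skip
  | SFor v e c1 =>
      Seq (NSet v (NLit 0) (NLit 0))
        (While (BNot (BNle e (nvar v)))
           (Seq (compile c1) (NSet v (NLit 0) (NAdd (nvar v) (NLit 1)))))
  end.

Fixpoint nreads (e : nexp) : seq nat :=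
  match e with
  | NLit _ => [::]
  | NGet a e1 => a :: nreads e1
  | NAdd e1 e2 | NSub e1 e2 => nreads e1 ++ nreads e2
  end.

Fixpoint nwrites (c : stm) : seq nat :=
  match c with
  | SN a _ _ => [:: a]
  | SR _ _ _ => [::]
  | SSeq c1 c2 => nwrites c1 ++ nwrites c2
  | SWhen _ c1 => nwrites c1
  | SFor v _ c1 => v :: nwrites c1
  end.

Fixpoint rwrites (c : stm) : seq nat :=
  match c with
  | SN _ _ _ => [::]
  | SR a _ _ => [:: a]
  | SSeq c1 c2 => rwrites c1 ++ rwrites c2
  | SWhen _ c1 | SFor _ _ c1 => rwrites c1
  end.

Fixpoint bound_reads (c : stm) : seq nat :=
  match c with
  | SN _ _ _ | SR _ _ _ => [::]
  | SSeq c1 c2 => bound_reads c1 ++ bound_reads c2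
  | SWhen _ c1 => bound_reads c1
  | SFor _ e c1 => nreads e ++ bound_reads c1
  end.

Fixpoint counters_safe (c : stm) : bool :=
  match c with
  | SN _ _ _ | SR _ _ _ => true
  | SSeq c1 c2 => counters_safe c1 && counters_safe c2
  | SWhen _ c1 => counters_safe c1
  | SFor v _ c1 => (v \notin nwrites c1) && counters_safe c1
  end.

(** Loop bounds then keep their initial values, although the compiled [While] evaluates them anew at
    each test. Counters count as written, so no bound may depend on an enclosing counter. *)
Definition bounds_safe (c : stm) : bool :=
  all (fun a => a \notin nwrites c) (bound_reads c).

(** In a loop, 11 pays for the control of one pass beyond evaluating [e]: 5 for the guard and 6 for
    the increment of the counter. *)
Fixpoint weight (c : stm) : nat :=
  match c with
  | SN _ e1 e2 => (nexp_cost e1 + nexp_cost e2).+1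
  | SR _ e1 e2 => (nexp_cost e1 + rexp_cost e2).+1
  | SSeq c1 c2 => weight c1 + weight c2
  | SWhen b c1 => (bexp_cost b + weight c1).+2
  | SFor _ e c1 => nexp_cost e + weight c1 + 11
  end.

Fixpoint depth (c : stm) : nat :=
  match c with
  | SN _ _ _ | SR _ _ _ => 0
  | SSeq c1 c2 => maxn (depth c1) (depth c2)
  | SWhen _ c1 => depth c1
  | SFor _ _ c1 => (depth c1).+1
  end.

(** * Denotational semantics of structured programs and their running time *)

Section Structured.
Variables (R : realType) (D : nat -> nat -> R).
Implicit Types (s : state R) (c : stm).

Definition nset s a i (v : nat) : state R := State (update (nmem s) a i v) (rmem s).
Definition rset s a i (v : R) : state R := State (nmem s) (update (rmem s) a i v).

Fixpoint sem c s : state R :=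
  match c with
  | SN a e1 e2 => nset s a (neval s e1) (neval s e2)
  | SR a e1 e2 => rset s a (neval s e1) (reval D s e2)
  | SSeq c1 c2 => sem c2 (sem c1 s)
  | SWhen b c1 => if beval D s b then sem c1 s else s
  | SFor v e c1 =>
      iteri (neval s e) (fun j s' => nset (sem c1 s') v 0 j.+1) (nset s v 0 0)
  end.

Fixpoint loops_below s (X : nat) c : bool :=
  match c with
  | SN _ _ _ | SR _ _ _ => true
  | SSeq c1 c2 => loops_below s X c1 && loops_below s X c2
  | SWhen _ c1 => loops_below s X c1
  | SFor _ e c1 => (neval s e < X)%N && loops_below s X c1
  end.

Lemma update_other (T : Type) (m : nat -> nat -> T) a i v b :
  b != a -> update m a i v b = m b.
Proof. by move=> /negbTE ba; rewrite /update ba. Qed.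

Lemma nmem_sem c s a : a \notin nwrites c -> nmem (sem c s) a = nmem s a.
Proof.
elim: c s => [b e1 e2|b e1 e2|c1 IH1 c2 IH2|b c1 IH1|v e c1 IH1] s //=.
- by rewrite inE => ab; rewrite update_other.
- by rewrite mem_cat negb_or => /andP[a1 a2]; rewrite IH2 ?IH1.
- by move=> a1; case: ifP => // _; rewrite IH1.
- rewrite inE negb_or => /andP[av a1].
  by elim: (neval s e) => /= [|j IHj]; rewrite update_other ?IH1.
Qed.

Lemma rmem_sem c s a : a \notin rwrites c -> rmem (sem c s) a = rmem s a.
Proof.
elim: c s => [b e1 e2|b e1 e2|c1 IH1 c2 IH2|b c1 IH1|v e c1 IH1] s //=.
- by rewrite inE => ab; rewrite update_other.
- by rewrite mem_cat negb_or => /andP[a1 a2]; rewrite IH2 ?IH1.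
- by move=> a1; case: ifP => // _; rewrite IH1.
- by move=> a1; elim: (neval s e) => //= j IHj; rewrite IH1.
Qed.

Lemma iter_for_frame v c s j :
  let s' := iteri j (fun i s' => nset (sem c s') v 0 i.+1) (nset s v 0 0) in
  [/\ nmem s' v 0 = j,
      (forall a, a \notin v :: nwrites c -> nmem s' a = nmem s a)
    & (forall a, a \notin rwrites c -> rmem s' a = rmem s a)].
Proof.
elim: j => /= [|j [vj nj rj]]; split=> //; try by rewrite /update !eqxx.
- by move=> a; rewrite inE negb_or => /andP[av _]; rewrite update_other.
- move=> a; rewrite inE negb_or => /andP[av ac].
  by rewrite update_other // nmem_sem // nj // inE negb_or av.
- by move=> a ac; rewrite rmem_sem // rj.
Qed.

(** Invariant rule for loops. The frame conditions are supplied for free, so an invariant [Q] only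
    has to describe what the body changes. *)
Lemma sem_forP v e c s (Q : nat -> state R -> Prop) :
    Q 0 (nset s v 0 0) ->
    (forall j s', (j < neval s e)%N -> nmem s' v 0 = j ->
       (forall a, a \notin v :: nwrites c -> nmem s' a = nmem s a) ->
       (forall a, a \notin rwrites c -> rmem s' a = rmem s a) ->
       Q j s' -> Q j.+1 (nset (sem c s') v 0 j.+1)) ->
  Q (neval s e) (sem (SFor v e c) s).
Proof.
move=> Q0 QS /=.
move: (leqnn (neval s e)); elim: {1 3 4}(neval s e) => [|j IHj] jN //=.
have [vj nj rj] := iter_for_frame v c s j.
by apply: QS => //; exact/IHj/ltnW.
Qed.

Lemma neval_eq s s' (e : nexp) :
  {in nreads e, nmem s' =1 nmem s} -> neval s' e = neval s e.
Proof.
elim: e => [m|a e IHe|e1 IH1 e2 IH2|e1 IH1 e2 IH2] //= es.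
- rewrite IHe ?es ?inE ?eqxx // => b be; apply: es.
  by rewrite inE be orbT.
- by rewrite IH1 1?IH2 // => b be; apply: es; rewrite mem_cat be ?orbT.
- by rewrite IH1 1?IH2 // => b be; apply: es; rewrite mem_cat be ?orbT.
Qed.

Lemma leq_weight_depth (w d d' X : nat) :
  (0 < X)%N -> (d <= d')%N -> (w * X ^ d <= w * X ^ d')%N.
Proof. by move=> X0 dd; rewrite leq_mul2l leq_pexp2l ?orbT. Qed.

(** Each nesting level multiplies the time by at most [X]. Bounds are judged in a fixed state [s0],
    because substatements start in intermediate states that agree with [s0] only on the arrays that
    bounds read. *)
Lemma exec_sem c s0 s (X : nat) :
    counters_safe c -> bounds_safe c ->
    {in bound_reads c, nmem s =1 nmem s0} ->
    loops_below s0 X c -> (0 < X)%N ->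
  exists2 t, (t <= weight c * X ^ depth c)%N & exec D (compile c) s t (sem c s).
Proof.
move=> + + + + X0; rewrite /bounds_safe.
elim: c s => [b e1 e2|b e1 e2|c1 IH1 c2 IH2|b c1 IH1|v e c1 IH1] s /=.
- by move=> _ _ _ _; eexists; last exact: ExecNSet; rewrite expn0 muln1.
- by move=> _ _ _ _; eexists; last exact: ExecRSet; rewrite expn0 muln1.
- move=> /andP[s1 s2] /allP bs eqs /andP[bX1 bX2].
  have bs1 a : a \in bound_reads c1 ++ bound_reads c2 ->
      (a \notin nwrites c1) && (a \notin nwrites c2).
    by move/bs; rewrite mem_cat negb_or.
  have sub1 a : a \in bound_reads c1 -> a \in bound_reads c1 ++ bound_reads c2.
    by rewrite mem_cat => ->.
  have sub2 a : a \in bound_reads c2 -> a \in bound_reads c1 ++ bound_reads c2.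
    by rewrite mem_cat orbC => ->.
  have [|||t1 le1 ex1] := IH1 s s1.
  + by apply/allP => a a1; have /andP[] := bs1 a (sub1 a a1).
  + by move=> a a1; apply: eqs; rewrite mem_cat a1.
  + by [].
  have [|||t2 le2 ex2] := IH2 (sem c1 s) s2.
  + by apply/allP => a a2; have /andP[] := bs1 a (sub2 a a2).
  + move=> a a2; rewrite nmem_sem; first by apply: eqs; rewrite mem_cat a2 orbT.
    by have /andP[] := bs1 a (sub2 a a2).
  + by [].
  exists (t1 + t2)%N; last exact: ExecSeq ex1 ex2.
  rewrite mulnDl leq_add //.
    by apply: leq_trans le1 _; rewrite leq_weight_depth // leq_maxl.
  by apply: leq_trans le2 _; rewrite leq_weight_depth // leq_maxr.
- move=> s1 bs eqs bX; have [t le1 ex1] := IH1 s s1 bs eqs bX.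
  have Xd : (0 < X ^ depth c1)%N by rewrite expn_gt0 X0.
  case: ifP => bE.
    exists (bexp_cost b + t).+1; first by nia.
    by apply: ExecIf; rewrite bE.
  exists (bexp_cost b + 1).+1; first by nia.
  by apply: ExecIf; rewrite bE; exact: ExecSkip.
- move=> /andP[vc s1] /allP bs eqs /andP[bX bXc].
  have Xd : (0 < X ^ depth c1)%N by rewrite expn_gt0 X0.
  have frame s' : (forall a, a \notin v :: nwrites c1 -> nmem s' a = nmem s a) ->
      neval s' e = neval s e /\ {in bound_reads c1, nmem s' =1 nmem s0}.
    move=> fr; split.
      apply: neval_eq => a ae; rewrite fr //; apply: bs.
      by rewrite mem_cat ae.
    move=> a ac; rewrite fr; last by apply: bs; rewrite mem_cat ac orbT.
    by apply: eqs; rewrite mem_cat ac orbT.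
  have eX : (neval s e < X)%N.
    rewrite (_ : neval s e = neval s0 e); last first.
      by apply: neval_eq => a ae; apply: eqs; rewrite mem_cat ae.
    by [].
  set F := fun j s' => nset (sem c1 s') v 0 j.+1.
  set W := While _ _.
  set w := (nexp_cost e + 11 + weight c1 * X ^ depth c1)%N.
  (* Here [j] passes are done and [i] remain; [nexp_cost e + 5] is the price of the last, failing
     guard. *)
  have loop : forall i j, (i + j)%N = neval s e ->
      exists2 t, (t <= i * w + nexp_cost e + 5)%N &
        exec D W (iteri j F (nset s v 0 0)) t (iteri (neval s e) F (nset s v 0 0)).
    elim=> [|i IHi] j ijN; have [vj nj _] := iter_for_frame v c1 s j;
        have [ej bj] := frame _ nj.
      exists (bexp_cost (BNot (BNle e (nvar v)))).+1; first by rewrite /=; lia.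
      rewrite -ijN; apply: ExecWhileDone.
      by rewrite /= vj ej -ijN leqnn.
    have [|t2 le2 ex2] := IHi j.+1; first by rewrite addnS -addSn.
    have [|||t1 le1 ex1] := IH1 (iteri j F (nset s v 0 0)) s1 => //.
    + apply/allP => a ac; have := bs a.
      by rewrite mem_cat ac orbT inE negb_or => /(_ isT)/andP[].
    have ex3 := ExecSeq ex1 (ExecNSet D _ v (NLit 0) (NAdd (nvar v) (NLit 1))).
    have vj1 : neval (sem c1 (iteri j F (nset s v 0 0)))
        (NAdd (nvar v) (NLit 1)) = j.+1 by rewrite /= nmem_sem // vj addn1.
    rewrite vj1 in ex3.
    eexists; last apply: (ExecWhileStep _ ex3 ex2).
      by rewrite /=; lia.
    by rewrite /= vj ej -ltnNge; lia.
  have [t le ex] := loop _ 0%N (addn0 _).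
  eexists; last exact: ExecSeq (ExecNSet D s v (NLit 0) (NLit 0)) ex.
  have wle : (w <= (nexp_cost e + weight c1 + 11) * X ^ depth c1)%N.
    by rewrite /w; nia.
  (* Initializing the counter and the last guard together cost less than one further pass, for which
     the strict bound [neval s e < X] leaves room. *)
  have tle : (3 + t <= X * w)%N.
    apply: (@leq_trans ((neval s e).+1 * w)); last by rewrite leq_mul2r eX orbT.
    by rewrite mulSn /w; lia.
  by rewrite expnS mulnCA; apply: leq_trans tle _; rewrite leq_mul2l wle orbT.
Qed.

End Structured.

(** * The algorithm *)

(* Integer arrays: 0 input, 1 and 2 output, 3 number of guesses, 4 accumulator,
   5 center of each point plus one (0 if uncovered), 6 center used in each step,
   7 digits of the guess, 8 and 9 division, 10 uncovered point, 11 current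
   center, 12 cluster sizes, 13 validity flag, 14 solution-found flag, 20 to 25
   loop counters.  Real arrays: 1 multiples of the unit, 2 ball radii, 3 their
   total, 4 best total so far, 5 the budget as a real number. *)
Definition nN : nexp := NGet 0 (NLit 0).
Definition kN : nexp := NGet 0 (NLit 1).
Definition lN : nexp := NGet 0 (NLit 2).
Definition k2N : nexp := NAdd kN kN.
Definition baseN : nexp := NAdd k2N (NLit 1).
Definition rvar (a : nat) : rexp := RGet a (NLit 0).

Definition nset0 (a : nat) (e : nexp) : stm := SN a (NLit 0) e.
Definition incr (a : nat) (e : nexp) : stm := SN a e (NAdd (NGet a e) (NLit 1)).
Definition rset0 (a : nat) (e : rexp) : stm := SR a (NLit 0) e.

(** Computes $(2k+1)^{2k}$ by repeated addition, as the machine does not multiply naturals. *)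
Definition count_guesses : stm :=
  SSeq (nset0 3 (NLit 1))
  (SFor 23 k2N
    (SSeq (nset0 4 (NLit 0))
    (SSeq (SFor 24 baseN (nset0 4 (NAdd (nvar 4) (nvar 3))))
          (nset0 3 (nvar 4))))).

(** Naturals cannot be converted to reals, so $k$ is counted up as a real number. *)
Definition real_budget : stm :=
  SSeq (rset0 5 (RLit 0)) (SFor 23 kN (rset0 5 (RAdd (rvar 5) (RLit 1)))).

(** Counters 20 and 21 hold the pair of points whose distance is the guess for [rmax]. Tabulating
    $0, u, \dots, 2ku$ lets a digit of the guess select a real number. *)
Definition unit_multiples : stm :=
  SSeq (rset0 1 (RLit 0))
  (SFor 23 k2N
    (SR 1 (NAdd (nvar 23) (NLit 1))
       (RAdd (RGet 1 (nvar 23)) (RDiv (RDist (nvar 20) (nvar 21)) (rvar 5))))).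

(** Division by $2k+1$ through repeated subtraction. The number of guesses exceeds the dividend,
    hence bounds the number of subtractions, and unlike the dividend it stays fixed during the
    loop. *)
Definition divide : stm :=
  SSeq (nset0 9 (NLit 0))
  (SFor 25 (nvar 3)
    (SWhen (BNle baseN (nvar 8))
      (SSeq (nset0 8 (NSub (nvar 8) baseN)) (incr 9 (NLit 0))))).

(** A guess is a number with $2k$ digits in base $2k+1$: digit $t$ is the growth in step $t$ as a
    multiple of $u$, and digit $k+t$ says which ball grows. *)
Definition decode : stm :=
  SSeq (nset0 8 (nvar 22))
  (SFor 23 k2N
    (SSeq divide
    (SSeq (SN 7 (nvar 23) (nvar 8))
          (nset0 8 (nvar 9))))).

(** Cell $|P|$ is included: it is a dummy center, chosen when no uncovered point is left. *)
Definition init_balls : stm :=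
  SSeq (rset0 3 (RLit 0))
  (SFor 24 (NAdd nN (NLit 1))
    (SSeq (SN 5 (nvar 24) (NLit 0)) (SR 2 (nvar 24) (RLit 0)))).

Definition pick_uncovered : stm :=
  SSeq (nset0 10 nN)
  (SFor 24 nN
    (SWhen (BNle (NGet 5 (nvar 24)) (NLit 0)) (nset0 10 (nvar 24)))).

Definition choose_center : stm :=
  SSeq (nset0 11 (nvar 10))
  (SSeq (SWhen (BNle (NAdd (NGet 7 (NAdd (nvar 23) kN)) (NLit 1)) (nvar 23))
           (nset0 11 (NGet 6 (NGet 7 (NAdd (nvar 23) kN)))))
        (SN 6 (nvar 23) (nvar 11))).

Definition grow_ball : stm :=
  SSeq (SR 2 (nvar 11) (RAdd (RGet 2 (nvar 11)) (RGet 1 (NGet 7 (nvar 23)))))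
       (rset0 3 (RAdd (rvar 3) (RGet 1 (NGet 7 (nvar 23))))).

Definition cover : stm :=
  SFor 24 nN
    (SWhen (BAnd (BNle (NGet 5 (nvar 24)) (NLit 0))
                 (BRle (RDist (nvar 24) (nvar 11)) (RGet 2 (nvar 11))))
       (SN 5 (nvar 24) (NAdd (nvar 11) (NLit 1)))).

Definition ball_step : stm :=
  SSeq pick_uncovered (SSeq choose_center (SSeq grow_ball cover)).

Definition cluster_size : stm :=
  SSeq (SN 12 (nvar 24) (NLit 0))
  (SFor 25 nN
    (SWhen (BAnd (BNle (NGet 5 (nvar 25)) (NAdd (nvar 24) (NLit 1)))
                 (BNle (NAdd (nvar 24) (NLit 1)) (NGet 5 (nvar 25))))
       (incr 12 (nvar 24)))).

Definition check : stm :=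
  SSeq (nset0 13 (NLit 1))
  (SFor 24 nN
    (SSeq cluster_size
    (SSeq (SWhen (BNle (NGet 5 (nvar 24)) (NLit 0)) (nset0 13 (NLit 0)))
          (SWhen (BAnd (BNle (NLit 1) (NGet 12 (nvar 24)))
                       (BNle (NAdd (NGet 12 (nvar 24)) (NLit 1)) lN))
             (nset0 13 (NLit 0)))))).

(** The flag in array 14 stands for an infinite best total before the first success. Cluster sizes
    serve as the center flags of the output. *)
Definition save : stm :=
  SWhen (BAnd (BNle (NLit 1) (nvar 13))
              (BNot (BAnd (BNle (NLit 1) (nvar 14)) (BRle (rvar 4) (rvar 3)))))
    (SSeq (nset0 14 (NLit 1))
    (SSeq (rset0 4 (rvar 3))
          (SFor 24 nN
             (SSeq (SN 1 (nvar 24) (NSub (NGet 5 (nvar 24)) (NLit 1)))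
                   (SN 2 (nvar 24) (NGet 12 (nvar 24))))))).

Definition ball_steps : stm := SFor 23 kN ball_step.

Definition attempt : stm :=
  SSeq decode (SSeq init_balls (SSeq ball_steps (SSeq check save))).

Definition setup : stm := SSeq count_guesses real_budget.

Definition search : stm :=
  SFor 20 nN (SFor 21 nN (SSeq unit_multiples (SFor 22 (nvar 3) attempt))).

(** The largest uncovered index below [i], with default [d]; the recursion follows the loop of
    [pick_uncovered], where later hits overwrite earlier ones. *)
Fixpoint last_uncovered (f : nat -> nat) (d i : nat) : nat :=
  if i is j.+1 then if (f j <= 0)%N then j else last_uncovered f d j else d.

(* [owner i] is the center of point [i] plus one, and 0 while [i] is uncovered;
   [used t] is the center of the ball grown in step [t]. *)
Record cover_state (R : realType) := CoverState {
  owner : nat -> nat;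
  used : nat -> nat;
  ball : nat -> R;
  spent : R
}.

(* A guess [a < t] grows the ball of step [a]; any other guess opens a new one. *)
Definition cover_step (R : realType) (D : nat -> nat -> R) (n : nat) (u : R)
    (t m a : nat) (M : cover_state R) : cover_state R :=
  let c := if (a < t)%N then used M a else last_uncovered (owner M) n n in
  let b := fun i => if i == c then ball M i + m%:R * u else ball M i in
  CoverState
    (fun i => if (owner M i <= 0)%N && (D i c <= b c) then c.+1 else owner M i)
    (fun i => if i == t then c else used M i) b (spent M + m%:R * u).

Arguments sem : simpl never.

(** * Effect of each program block on the memory *)

Section Blocks.
Variables (R : realType) (D : nat -> nat -> R).
Implicit Types (s : state R).

Lemma iota0S j : iota 0 j.+1 = iota 0 j ++ [:: j].
Proof. by rewrite -addn1 iotaD. Qed.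

Lemma semE :
  ((forall a e1 e2 s, sem D (SN a e1 e2) s = nset s a (neval s e1) (neval s e2)) *
   (forall a e1 e2 s, sem D (SR a e1 e2) s = rset s a (neval s e1) (reval D s e2)) *
   (forall c1 c2 s, sem D (SSeq c1 c2) s = sem D c2 (sem D c1 s)) *
   (forall b c s, sem D (SWhen b c) s = if beval D s b then sem D c s else s))%type.
Proof. by []. Qed.

Lemma sem_count_guesses s :
  let k2 := (nmem s 0 1 + nmem s 0 1)%N in
  nmem (sem D count_guesses s) 3 0 = ((k2 + 1) ^ k2)%N.
Proof.
move=> k2; rewrite /count_guesses /nset0 !semE.
set L := SFor 23 _ _; set s1 := nset _ _ _ _.
pose Q j s' := nmem s' 3 0 = ((k2 + 1) ^ j)%N :> nat.
change (Q (neval s1 k2N) (sem D L s1)).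
apply: sem_forP => // j s' jk vj nj rj Qj.
rewrite /Q !semE; set L2 := SFor 24 _ _; set s2 := nset s' 4 _ _.
have : nmem (sem D L2 s2) 4 0 = (neval s2 baseN * (k2 + 1) ^ j)%N.
  pose Q2 i s' := nmem s' 4 0 = (i * (k2 + 1) ^ j)%N :> nat.
  change (Q2 (neval s2 baseN) (sem D L2 s2)).
  apply: sem_forP => // i s'' ik vi ni ri Qi.
  by rewrite /Q2 !semE /= /update /= (ni 3) //= Qi mulSn addnC -Qj.
have -> : neval s2 baseN = (k2 + 1)%N.
  by have n0 : nmem s2 0 = nmem s 0 := nj 0 isT; rewrite -[LHS]/(_ + _ + 1)%N n0.
by rewrite -expnS.
Qed.

Lemma sem_real_budget s : rmem (sem D real_budget s) 5 0 = (nmem s 0 1)%:R.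
Proof.
rewrite /real_budget /rset0 !semE.
set L := SFor 23 _ _; set s1 := rset _ _ _ _.
pose Q j s' := rmem s' 5 0 = j%:R :> R.
change (Q (neval s1 kN) (sem D L s1)).
apply: sem_forP => // [|j s' jk vj nj rj Qj]; rewrite /Q ?semE /=.
  by rewrite /update /= rmorph0.
by rewrite /update /= Qj rmorph1 -natr1.
Qed.

Lemma sem_unit_multiples s m :
  (m <= nmem s 0 1 + nmem s 0 1)%N ->
  rmem (sem D unit_multiples s) 1 m =
    m%:R * (D (nmem s 20 0) (nmem s 21 0) / rmem s 5 0).
Proof.
set u := D _ _ / _.
rewrite /unit_multiples /rset0 !semE.
set L := SFor 23 _ _; set s1 := rset _ _ _ _.
pose Q j s' := forall i, (i <= j)%N -> rmem s' 1 i = i%:R * u :> R.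
move: m; change (Q (neval s1 k2N) (sem D L s1)).
apply: sem_forP => // [|j s' jk vj nj rj Qj] i ij /=.
  by rewrite /update /= (_ : i = 0%N) ?rmorph0 ?mul0r //; lia.
rewrite /update /= vj addn1; case: eqP => [->|ne]; last by apply: Qj; lia.
rewrite Qj // (nj 20%N) // (nj 21%N) // rj // /s1 /=.
by rewrite -natr1 mulrDl mul1r.
Qed.

Lemma sem_divide s :
  (nmem s 8 0 < nmem s 3 0)%N ->
  let b := (nmem s 0 1 + nmem s 0 1 + 1)%N in
  nmem (sem D divide s) 9 0 = (nmem s 8 0 %/ b)%N /\
  nmem (sem D divide s) 8 0 = (nmem s 8 0 %% b)%N.
Proof.
move=> xH b; set x := nmem s 8 0 in xH *.
rewrite /divide /nset0 /incr !semE.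
set L := SFor 25 _ _; set s1 := nset _ _ _ _.
(* Either the remainder is already reduced, or every one of the [j] rounds has subtracted once. *)
pose Q j s' := (nmem s' 9 0 * b + nmem s' 8 0 = x)%N /\
  ((nmem s' 8 0 < b)%N \/ nmem s' 9 0 = j).
have [] : Q (neval s1 (nvar 3)) (sem D L s1).
  apply: sem_forP => [|j s' jk vj nj rj [Qe Qj]]; first by split=> //; right.
  rewrite /Q !semE /= (nj 0) //= -/b.
  case: (leqP b (nmem s' 8 0)) => bs; rewrite /update /=.
    split; first by rewrite mulnDl mul1n -addnA subnKC.
    by case: Qj => [|->]; [rewrite ltnNge bs | right; rewrite addn1].
  by split=> //; left.
set q := nmem _ 9 0; set r := nmem _ 8 0 => qr /= [rb|qH].
  by rewrite -qr divnMDl ?modnMDl ?divn_small ?modn_small ?addn0 // /b; lia.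
(* A subtraction in every round would make the quotient equal to the number of guesses, which is
   larger than [x]. *)
rewrite /update /= in qH; move: xH; rewrite -qr -qH /b.
by move: (nmem s 0 1 + nmem s 0 1)%N => k2; nia.
Qed.

Lemma sem_decode s t :
  (nmem s 22 0 < nmem s 3 0)%N ->
  let b := (nmem s 0 1 + nmem s 0 1 + 1)%N in
  (t < nmem s 0 1 + nmem s 0 1)%N ->
  nmem (sem D decode s) 7 t = ((nmem s 22 0 %/ b ^ t) %% b)%N.
Proof.
move=> gH b; set g := nmem s 22 0 in gH *.
rewrite /decode /nset0 !semE; set L := SFor 23 _ _; set s1 := nset _ _ _ _.
pose Q j s' := nmem s' 8 0 = (g %/ b ^ j)%N /\
  forall i, (i < j)%N -> nmem s' 7 i = ((g %/ b ^ i) %% b)%N :> nat.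
suff : Q (neval s1 k2N) (sem D L s1) by case=> _; apply.
apply: sem_forP => [|j s' jk vj nj rj [Q8 Q7]].
  by split; rewrite //= expn0 divn1 /update /=.
have [|d9 d8] := sem_divide (s := s').
  by rewrite Q8 (nj 3) //; apply: leq_ltn_trans (leq_div _ _) gH.
have n23 : nmem (sem D divide s') 23 0 = j by rewrite nmem_sem.
have n7 : nmem (sem D divide s') 7 = nmem s' 7 by rewrite nmem_sem.
have n0 : nmem s' 0 = nmem s 0 := nj 0 isT.
rewrite /Q semE; set s2 := sem D divide s' in d9 d8 n23 n7 *.
rewrite Q8 n0 -/b in d9 d8.
rewrite !semE /= /update /= n23 d9 d8 n7; split.
  by rewrite -divnMA expnSr.
move=> i ij; case: eqP => [->//|ne].
by rewrite Q7 //; lia.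
Qed.

Lemma sem_init_balls s :
  let s' := sem D init_balls s in
  [/\ forall i, (i < nmem s 0 0)%N -> nmem s' 5 i = 0%N,
      forall i, (i <= nmem s 0 0)%N -> rmem s' 2 i = 0 & rmem s' 3 0 = 0].
Proof.
rewrite /init_balls /rset0 !semE; set L := SFor 24 _ _; set s1 := rset _ _ _ _.
pose Q j s' := forall i, (i < j)%N -> nmem s' 5 i = 0%N /\ rmem s' 2 i = 0 :> R.
have H : Q (neval s1 (NAdd nN (NLit 1))) (sem D L s1).
  apply: sem_forP => // j s' jk vj nj rj Qj i ij /=.
  rewrite /update /= vj rmorph0; case: eqP => [//|ne]; apply: Qj; lia.
split=> [i ni|i ni|].
- by apply: (H i _).1; rewrite /s1 /=; lia.
- by apply: (H i _).2; rewrite /s1 /=; lia.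
- by rewrite rmem_sem //= /update /= rmorph0.
Qed.

Lemma sem_pick_uncovered s :
  nmem (sem D pick_uncovered s) 10 0 =
    last_uncovered (nmem s 5) (nmem s 0 0) (nmem s 0 0).
Proof.
rewrite /pick_uncovered /nset0 !semE; set L := SFor 24 _ _; set s1 := nset _ _ _ _.
pose Q j s' := nmem s' 10 0 = last_uncovered (nmem s 5) (nmem s 0 0) j.
change (Q (neval s1 nN) (sem D L s1)).
apply: sem_forP => // j s' jk vj nj rj Qj.
by rewrite /Q !semE /= (nj 5) // vj /=; case: leqP => _; rewrite /= /update /=.
Qed.

Lemma sem_choose_center s :
  let a := nmem s 7 (nmem s 23 0 + nmem s 0 1)%N in
  let c := if (a < nmem s 23 0)%N then nmem s 6 a else nmem s 10 0 in
  nmem (sem D choose_center s) 11 0 = c /\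
  nmem (sem D choose_center s) 6 =1
    fun i => if i == nmem s 23 0 then c else nmem s 6 i.
Proof.
move=> a c; rewrite /choose_center /nset0 !semE /= /update /= addn1 -/a /c.
by case: ifP => _ //=; split=> // i; rewrite /update /=; case: eqP.
Qed.

Lemma sem_cover s i :
  (i < nmem s 0 0)%N ->
  nmem (sem D cover s) 5 i =
    if (nmem s 5 i <= 0)%N && (D i (nmem s 11 0) <= rmem s 2 (nmem s 11 0))
    then (nmem s 11 0).+1 else nmem s 5 i.
Proof.
pose F i := if (nmem s 5 i <= 0)%N && (D i (nmem s 11 0) <= rmem s 2 (nmem s 11 0))
  then (nmem s 11 0).+1 else nmem s 5 i.
rewrite -/(F i); move: i.
(* The loop writes neither the center nor the radii, so each point is decided independently of the
   others. *)
pose Q j s' := forall i, nmem s' 5 i = if (i < j)%N then F i else nmem s 5 i.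
suff H : Q (nmem s 0 0) (sem D cover s) by move=> i ni; rewrite H ni.
change (Q (neval s nN) (sem D cover s)).
apply: sem_forP => // j s' jk vj nj rj Qj i.
rewrite !semE /= vj (nj 11%N) // rj // Qj ltnn ltnS /F.
have [->|ij] := eqVneq i j.
  rewrite leqnn /update /=; case: ifP => _ /=; last by rewrite Qj ltnn.
  by rewrite /update /= eqxx addn1.
rewrite (leq_eqVlt i) (negbTE ij) /=.
by case: ifP => _ /=; rewrite /update /= ?(negbTE ij) Qj.
Qed.

Lemma sem_cluster_size s :
  nmem (sem D cluster_size s) 12 =1 fun i =>
    if i == nmem s 24 0
    then count (fun j => nmem s 5 j == i.+1) (iota 0 (nmem s 0 0))
    else nmem s 12 i.
Proof.
rewrite /cluster_size /incr !semE; set L := SFor 25 _ _; set s1 := nset _ _ _ _.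
pose Q m s' := forall i, nmem s' 12 i = if i == nmem s 24 0
    then count (fun j => nmem s 5 j == i.+1) (iota 0 m) else nmem s 12 i.
change (Q (neval s1 nN) (sem D L s1)).
apply: sem_forP => [i|j s' jk vj nj rj Qj i].
  by rewrite ?semE /= /update /=; case: eqP.
rewrite iota0S count_cat !semE /= vj (nj 5) // (nj 24) // /update /=.
rewrite addn1 -eqn_leq addn0.
case: (eqVneq i (nmem s 24 0)) => [->|ne]; case: (eqVneq (nmem s 5 j) _) => [e|e];
  by rewrite /= /update /= ?eqxx ?(negbTE ne) ?Qj ?eqxx ?(negbTE ne) ?addn0.
Qed.


Lemma sem_check s :
  let s' := sem D check s in
  let size i := count (fun j => nmem s 5 j == i.+1) (iota 0 (nmem s 0 0)) in
  (forall i, (i < nmem s 0 0)%N -> nmem s' 12 i = size i) /\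
  (0 < nmem s' 13 0)%N =
    all (fun i => (0 < nmem s 5 i)%N && ((0 < size i)%N ==> (nmem s 0 2 <= size i)%N))
      (iota 0 (nmem s 0 0)).
Proof.
move=> s' size; rewrite {}/s'.
rewrite /check /nset0 !semE; set L := SFor 24 _ _; set s1 := nset _ _ _ _.
pose Q m s' := (forall i, (i < m)%N -> nmem s' 12 i = size i) /\
  (0 < nmem s' 13 0)%N =
    all (fun i => (0 < nmem s 5 i)%N && ((0 < size i)%N ==> (nmem s 0 2 <= size i)%N))
      (iota 0 m).
change (Q (neval s1 nN) (sem D L s1)).
apply: sem_forP => // j s' jk vj nj rj [Q1 Q2].
have H12 i : nmem (sem D cluster_size s') 12 i =
    if i == j then size i else nmem s' 12 i.
  by rewrite sem_cluster_size vj (nj 5) // (nj 0).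
rewrite /Q semE; set s2 := sem D cluster_size s' in H12 *.
have n5 : nmem s2 5 = nmem s 5 by rewrite nmem_sem ?nj.
have n24 : nmem s2 24 0 = j by rewrite nmem_sem.
have n13 : nmem s2 13 0 = nmem s' 13 0 by rewrite nmem_sem.
have n0 : nmem s2 0 = nmem s 0 by rewrite nmem_sem ?nj.
rewrite iota0S all_cat -Q2 !semE /= n24 n5.
set s3 := if (_ <= 0)%N then _ else _.
have n12 : nmem s3 12 = nmem s2 12 by rewrite /s3; case: ifP.
have n03 : nmem s3 0 = nmem s 0 by rewrite /s3; case: ifP.
have n243 : nmem s3 24 0 = j by rewrite /s3; case: ifP.
have n133 : (0 < nmem s3 13 0)%N = (0 < nmem s' 13 0)%N && (0 < nmem s 5 j)%N.
  by rewrite /s3; case: (leqP (nmem s 5 j) 0) => _ /=; rewrite /update /= ?n13 ?andbF ?andbT.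
rewrite n12 n03 n243 H12 eqxx /update /=; split=> [i ij|].
  rewrite (_ : nmem _ 12 i = nmem s3 12 i); last by case: ifP.
  by rewrite n12 H12; case: eqP => // ne; apply: Q1; lia.
rewrite andbT addn1 andbA -n133.
case: (ltnP 0 (size j)) => _ /=; last by rewrite andbT.
by case: (leqP (nmem s 0 2) (size j)) => _ /=; rewrite /update /= ?andbT ?andbF.
Qed.

Lemma sem_save s :
  let s' := sem D save s in
  if (0 < nmem s 13 0)%N && ~~ ((0 < nmem s 14 0)%N && (rmem s 4 0 <= rmem s 3 0))
  then [/\ nmem s' 14 0 = 1%N, rmem s' 4 0 = rmem s 3 0
         & forall i, (i < nmem s 0 0)%N ->
             nmem s' 1 i = (nmem s 5 i).-1 /\ nmem s' 2 i = nmem s 12 i]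
  else s' = s.
Proof.
rewrite /save semE /=; case: (_ && _) => //.
rewrite /nset0 /rset0 !semE; set L := SFor 24 _ _; set s1 := rset _ _ _ _.
split; try by rewrite ?nmem_sem ?rmem_sem.
pose Q j s' := forall i, (i < j)%N ->
  nmem s' 1 i = (nmem s 5 i).-1 /\ nmem s' 2 i = nmem s 12 i.
change (Q (neval s1 nN) (sem D L s1)).
apply: sem_forP => // j s' jk vj nj rj Qj i ij.
rewrite !semE /= /update /= vj (nj 5) // (nj 12) // /s1 /=.
by case: eqP => [->|ne]; [rewrite subn1 | apply: Qj; lia].
Qed.

Lemma last_uncovered_leq f d i : (i <= d)%N -> (last_uncovered f d i <= d)%N.
Proof.
by elim: i => //= i IHi id; case: ifP => _; [exact: ltnW | apply/IHi/ltnW].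
Qed.

Lemma eq_last_uncovered f g d i :
  (forall j, (j < i)%N -> f j = g j) -> last_uncovered f d i = last_uncovered g d i.
Proof.
elim: i => //= i IHi fg; rewrite fg // IHi // => j ji; exact/fg/ltnW.
Qed.

(** The ranges matter: array 6 is not cleared between guesses, so only its first [t] cells are
    meaningful, and radii are tracked up to the dummy center [n]. *)
Definition agrees (n t : nat) s (M : cover_state R) : Prop :=
  [/\ forall i, (i < n)%N -> nmem s 5 i = owner M i,
      forall i, (i < t)%N -> nmem s 6 i = used M i,
      forall i, (i <= n)%N -> rmem s 2 i = ball M i
    & rmem s 3 0 = spent M].

Lemma sem_ball_step s n k u t M :
    nmem s 0 0 = n -> nmem s 0 1 = k -> nmem s 23 0 = t ->
    (forall m, (m <= k + k)%N -> rmem s 1 m = m%:R * u) ->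
    (nmem s 7 t <= k + k)%N ->
    (forall i, (i < t)%N -> (used M i <= n)%N) ->
    agrees n t s M ->
  agrees n t.+1 (sem D ball_step s)
    (cover_step D n u t (nmem s 7 t) (nmem s 7 (t + k)) M).
Proof.
move=> n0 k0 t0 um m2 un [ow us ba to].
rewrite /ball_step semE; have := sem_pick_uncovered s.
have : forall a, a \notin nwrites pick_uncovered ->
  nmem (sem D pick_uncovered s) a = nmem s a by move=> a ha; rewrite nmem_sem.
have : forall a, rmem (sem D pick_uncovered s) a = rmem s a.
  by move=> a; rewrite rmem_sem.
move: (sem D pick_uncovered s) => s1 r1 n1 p1.
rewrite n0 (eq_last_uncovered (g := owner M)) // in p1.
have pn := last_uncovered_leq (owner M) (leqnn n).
rewrite semE; have := sem_choose_center s1.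
have : forall a, a \notin nwrites choose_center ->
  nmem (sem D choose_center s1) a = nmem s1 a by move=> a ha; rewrite nmem_sem.
have : forall a, rmem (sem D choose_center s1) a = rmem s1 a.
  by move=> a; rewrite rmem_sem.
move: (sem D choose_center s1) => s2 r2 n2.
rewrite n1 // n1 // n1 // n1 // t0 k0 p1.
set a := nmem s 7 (t + k); set m := nmem s 7 t.
rewrite /cover_step /=; set c := if (a < t)%N then _ else _.
rewrite (_ : c = if (a < t)%N then used M a else last_uncovered (owner M) n n);
  last by rewrite /c; case: ltnP => // /us.
move: c => _; set c := if (a < t)%N then _ else _ => -[c2 u2].
have cn : (c <= n)%N by rewrite /c; case: ltnP => // /un.
have n7 : nmem s2 7 = nmem s 7 by rewrite n2 // n1.
have n23 : nmem s2 23 0 = t by rewrite n2 // n1.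
rewrite semE /grow_ball /rset0 !semE /=; set s3 := rset _ 3 _ _.
have um1 : rmem s2 1 m = m%:R * u by rewrite r2 r1 um.
have b3 i : (i <= n)%N -> rmem s3 2 i = if i == c then ball M i + m%:R * u else ball M i.
  move=> i_n; rewrite /s3 /= /update /= c2 n7 n23 um1 r2 r1 !ba //.
  by case: eqP => // ->.
have t3 : rmem s3 3 0 = spent M + m%:R * u.
  by rewrite /s3 /= /update /= n7 n23 um1 r2 r1 to.
have n30 : nmem s3 0 0 = n by rewrite -[LHS]/(nmem s2 0 0) n2 // n1.
split=> [i i_n|i it|i i_n|]; rewrite ?rmem_sem ?b3 //=.
- rewrite sem_cover ?n30 // b3 c2 // -[nmem s3 5]/(nmem s2 5) n2 // n1 // ow //.
- rewrite nmem_sem // -[nmem s3 6]/(nmem s2 6) u2; case: eqP => // ne.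
  by rewrite us //; lia.
Qed.

End Blocks.

(** * Correctness of the covering process *)

Lemma sub_in_count (T : eqType) (a b : pred T) (s : seq T) :
  {in s, forall x, a x -> b x} -> (count a s <= count b s)%N.
Proof.
elim: s => //= x s IHs ab; apply: leq_add.
  by case: (a x) (ab x) => //= -> //; rewrite inE eqxx.
by apply: IHs => y ys; apply: ab; rewrite inE ys orbT.
Qed.

(** * Invariants of the covering process under arbitrary guesses *)

Section Covering.
Variables (R : realType) (D : nat -> nat -> R) (n : nat) (u : R).
Hypothesis u_ge0 : 0 <= u.
Implicit Type M : cover_state R.

Definition cover_init : cover_state R :=
  CoverState (fun=> 0%N) (fun=> 0%N) (fun=> 0) 0.

Fixpoint cover_run (gm ga : nat -> nat) (t : nat) : cover_state R :=
  if t is t'.+1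
  then cover_step D n u t' (gm t') (ga t') (cover_run gm ga t')
  else cover_init.

Lemma eq_cover_run gm ga gm' ga' t :
  (forall i, (i < t)%N -> gm i = gm' i) -> (forall i, (i < t)%N -> ga i = ga' i) ->
  cover_run gm ga t = cover_run gm' ga' t.
Proof.
elim: t => //= t IHt em ea; rewrite em // ea // IHt // => i it.
  exact/em/ltnW.
exact/ea/ltnW.
Qed.

Lemma last_uncoveredP (f : nat -> nat) d i :
  (exists2 j, (j < i)%N & f j = 0%N) ->
  (last_uncovered f d i < i)%N /\ f (last_uncovered f d i) = 0%N.
Proof.
elim: i => [|i IHi] [j ji fj] //=; case: (leqP (f i) 0) => [|fi].
  by rewrite leqn0 => /eqP.
have [|ltu fu] := IHi; last by split=> //; exact: ltnW.
exists j => //; rewrite ltn_neqAle -ltnS ji andbT.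
by apply: contraTneq fi => <-; rewrite fj.
Qed.

(** True for good and bad guesses alike. Since every owner is the center of some step, at most [t]
    centers own points, and [spent] bounds the sum of their radii. The dummy center [n] can occur
    only once all points are covered. *)
Record cover_sound (t : nat) M : Prop := CoverSound {
  used_le : forall i, (i < t)%N -> (used M i <= n)%N;
  used_lt : (exists2 i, (i < n)%N & owner M i = 0%N) ->
    forall i, (i < t)%N -> (used M i < n)%N;
  ownerP : forall i c, (i < n)%N -> owner M i = c.+1 ->
    [/\ (c < n)%N, D i c <= ball M c & exists2 j, (j < t)%N & used M j = c];
  ball_ge0 : forall i, 0 <= ball M i;
  spent_ge : \sum_(i < n) ball M i <= spent M
}.

Lemma cover_init_sound : cover_sound 0 cover_init.
Proof. by split=> //=; rewrite big1. Qed.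

Lemma cover_step_sound t m a M :
  cover_sound t M -> cover_sound t.+1 (cover_step D n u t m a M).
Proof.
move=> [ul ult oP b0 tot]; have mu0 : 0 <= m%:R * u by rewrite mulr_ge0.
pose c := if (a < t)%N then used M a else last_uncovered (owner M) n n.
have cn : (c <= n)%N by rewrite /c; case: (ltnP a t) => [/ul|_] //; exact: last_uncovered_leq.
have cn' : (exists2 i, (i < n)%N & owner M i = 0%N) -> (c < n)%N.
  by move=> ex; rewrite /c; case: (ltnP a t) => [/(ult ex)|_] //; case: (last_uncoveredP n ex).
have bM i : ball M i <= (if i == c then ball M i + m%:R * u else ball M i).
  by case: ifP => // _; rewrite lerDl.
split=> /=; rewrite -/c.
- by move=> i it; case: eqP => // ne; apply: ul; lia.
- move=> [i i_n]; case: ifP => // _ oi j jt.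
  have ex : exists2 i, (i < n)%N & owner M i = 0%N by exists i.
  by case: eqP => [_|ne]; [exact: cn' | apply: (ult ex); lia].
- move=> i c' i_n; case: ifP => [/andP[oi Dc] [<-]|_ oc].
    split=> //; last by exists t; rewrite ?eqxx.
    by apply: cn'; exists i => //; apply/eqP; rewrite -leqn0.
  have [c'n Dc' [j jt uj]] := oP _ _ i_n oc; split=> //.
    exact: le_trans Dc' (bM _).
  by exists j; [exact: ltnW | rewrite ltn_eqF].
- by move=> i; exact: le_trans (b0 i) (bM i).
(* Only ball [c] grows; if [c] is the dummy center, the growth is paid for but does not appear in
   the sum. *)
- apply: (@le_trans _ _ (\sum_(i < n) (ball M i + if i == c :> nat then m%:R * u else 0))).
    by apply: ler_sum => i _; case: ifP; rewrite ?addr0.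
  rewrite big_split lerD //= -big_mkcond /=.
  have [cn''|nc] := ltnP c n; last first.
    by rewrite big_pred0 // => i; rewrite ltn_eqF // (leq_trans (ltn_ord i)).
  by rewrite (big_pred1 (Ordinal cn'')).
Qed.

Lemma cover_run_sound gm ga t : cover_sound t (cover_run gm ga t).
Proof.
by elim: t => [|t IHt] /=; [exact: cover_init_sound | exact: cover_step_sound].
Qed.

(** * Guesses that follow a given clustering *)

Section Completeness.
(** The clustering to be followed: [cl i] is the center of point [i], [J0] lists the centers and [r]
    gives their radii. The bound [r_le] holds because $ku$ will be the largest radius. *)
Variables (k l : nat) (cl : nat -> nat) (r : nat -> R) (J0 : seq nat).
Hypotheses (D_sym : forall x y, D x y = D y x)
  (D_tri : forall x y z, (x < n)%N -> (y < n)%N -> (z < n)%N ->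
     D x z <= D x y + D y z).
Hypotheses (J0_uniq : uniq J0) (J0_size : (size J0 <= k)%N)
  (J0_lt : {in J0, forall j, (j < n)%N})
  (cl_in : forall i, (i < n)%N -> cl i \in J0)
  (cl_r : forall i, (i < n)%N -> D i (cl i) <= r (cl i))
  (cl_size : {in J0, forall j, (l <= count (fun i => cl i == j) (iota 0 n))%N})
  (r_ge0 : {in J0, forall j, 0 <= r j})
  (r_le : {in J0, forall j, r j <= k%:R * u}).

(* [J] collects the optimal clusters already swallowed: each step spends the
   diameter bound [2 * r j], rounded up to a multiple of [u], on a new one. *)
Record cover_good (t : nat) M (J : seq nat) : Prop := CoverGood {
  good_uniq : uniq J;
  good_sub : {subset J <= J0};
  good_covered : forall i, (i < n)%N -> cl i \in J -> owner M i <> 0%N;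
  good_spent : spent M <= \sum_(j <- J) (2 * r j + u);
  good_size : forall i c, (i < n)%N -> owner M i = c.+1 ->
    (l <= count (fun j => owner M j == c.+1) (iota 0 n))%N;
  good_progress : size J = t \/ forall i, (i < n)%N -> owner M i <> 0%N
}.

(** Take the least multiple above [x]: its predecessor lies below [x], so the excess is at most [u],
    and [k + k] is itself a competitor. *)
Lemma rounded_multiple (x : R) :
  0 <= x -> x <= (k + k)%:R * u ->
  exists m, [/\ (m <= k + k)%N, x <= m%:R * u & m%:R * u <= x + u].
Proof.
move=> x0 xk; have ex : exists m, x <= m%:R * u by exists (k + k)%N.
exists (ex_minn ex); case: ex_minnP => m xm mmin; split=> //; first exact: mmin.
case: m xm mmin => [|m] xm mmin; first by rewrite mul0r addr_ge0.
rewrite -natr1 mulrDl mul1r lerD2r leNgt; apply/negP => xm'.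
by have := mmin _ (ltW xm'); rewrite ltnn.
Qed.

Lemma cover_step_good t M J :
  cover_sound t M -> cover_good t M J -> (t < k)%N ->
  exists m a J', [/\ (m <= k + k)%N, (a < k)%N
    & cover_good t.+1 (cover_step D n u t m a M) J'].
Proof.
move=> [ul ult oP b0 tot] [Ju Jsub Jcov Jtot Jsize Jprog] tk.
have [/allP cov|] := boolP (all (fun i => 0 < owner M i)%N (iota 0 n)).
  have cov' i : (i < n)%N -> (owner M i <= 0)%N = false.
    by move=> i_n; apply/negbTE; rewrite -ltnNge; apply: cov; rewrite mem_iota.
  (* Once all is covered, the step adds 0 to the dummy ball. [J] stays as it is, which the second
     alternative of [good_progress] permits. *)
  exists 0%N, t, J; split=> //; split=> //=.
  - by move=> i i_n; rewrite cov' // => /(Jcov _ i_n).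
  - by rewrite mul0r addr0.
  - move=> i c i_n; rewrite cov' // => /(Jsize _ _ i_n) /leq_trans; apply.
    rewrite leq_eqVlt; apply/orP; left; apply/eqP; apply: eq_in_count => j.
    by rewrite mem_iota /= => j_n; rewrite cov'.
  - by right=> i i_n; rewrite cov' //= => oi; have := cov' _ i_n; rewrite oi.
rewrite -has_predC => /hasP[i0]; rewrite mem_iota /= -leqNgt leqn0 => i0n /eqP oi0.
have ex : exists2 i, (i < n)%N & owner M i = 0%N by exists i0.
have [] := last_uncoveredP n ex; set p := last_uncovered _ _ _ => pn op.
have {Jprog} sJ : size J = t by case: Jprog => // /(_ _ i0n).
set j := cl p; have jJ0 : j \in J0 by exact: cl_in.
(* Clusters in [J] are covered and [p] is not, so its cluster is new. *)
have jJ : j \notin J by apply/negP => /(Jcov _ pn).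
have [|| m [mk rm mr]] := rounded_multiple (x := 2 * r j).
- by rewrite mulr_ge0 // r_ge0.
- by rewrite natrD -mulr2n -[k%:R *+ 2]mulr_natl -mulrA ler_wpM2l // r_le.
have diam i i' : (i < n)%N -> (i' < n)%N -> cl i = j -> cl i' = j -> D i i' <= m%:R * u.
  move=> i_n i'n ci ci'; apply: le_trans rm.
  apply: le_trans (D_tri i_n (J0_lt jJ0) i'n) _.
  have := cl_r i_n; have := cl_r i'n; rewrite ci ci' [D i' _]D_sym.
  by move=> h1 h2; rewrite mulr2n mulrDl mul1r lerD.
(* Any center whose grown ball contains the whole cluster [j] will do, provided
   it either owns enough points already or receives all of cluster [j]. *)
suff [a ak [cn growj big]] : exists2 a, (a < k)%N &
    let c := if (a < t)%N then used M a else p in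
    [/\ (c < n)%N, forall i, (i < n)%N -> cl i = j -> owner M i = 0%N ->
          D i c <= ball M c + m%:R * u
      & (exists2 i, (i < n)%N & owner M i = c.+1) \/
        forall i, (i < n)%N -> cl i = j -> owner M i = 0%N].
  exists m, a, (j :: J); split=> //; split=> //=.
  - by rewrite jJ.
  - by move=> x; rewrite inE => /orP[/eqP->|/Jsub].
  - move=> i i_n; rewrite inE => /orP[/eqP ci|ciJ].
      case: ifP => // /negbT; rewrite eqxx negb_and => /orP[|/negP nD oi].
        by rewrite -ltnNge; case: owner.
      by case: nD; exact: growj.
    by case: ifP => // _; exact: Jcov.
  - rewrite big_cons addrC lerD //; lra.
  - rewrite -/p; move: cn growj big; set c := if (a < t)%N then _ else _ => cn growj big.
    rewrite eqxx.
    (* An owner is never replaced, so the points owned by a center can only increase. *)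
    have mono c' : (count (fun i => owner M i == c'.+1) (iota 0 n) <=
        count (fun i => (if (owner M i <= 0) && (D i c <= ball M c + m%:R * u)%R
                         then c.+1 else owner M i) == c'.+1) (iota 0 n))%N.
      by apply: sub_count => i /= /eqP oi; rewrite oi eqxx.
    move=> i c' i_n oi'.
    (* Either [c'] owned a point before this step and was already large enough, or it is the new
       ball, which receives all of cluster [j]. *)
    have [[i1 i1n oi1]|cold] : (exists2 i1, (i1 < n)%N & owner M i1 = c'.+1) \/
        (c' = c /\ forall i, (i < n)%N -> cl i = j -> owner M i = 0%N).
      move: oi'; case: ifP => [_ [<-]|_ oi]; last by left; exists i.
      by case: big => ?; [left | right].
    - exact: leq_trans (Jsize _ _ i1n oi1) (mono c').
    - have [-> free] := cold; apply: leq_trans (cl_size jJ0) _.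
      apply: sub_in_count => x; rewrite mem_iota /= => xn /eqP cx.
      by rewrite free // growj ?free //= eqxx.
  - by left; rewrite sJ.
(* If some [z] of the cluster lies in the ball of [c], growing that ball by the diameter of the
   cluster reaches all of it through [z]. Otherwise the whole cluster is free and a ball around [p]
   takes it. *)
have [/hasP[z]|none] := boolP (has (fun i => (cl i == j) && (0 < owner M i)%N) (iota 0 n)).
  rewrite mem_iota /= => zn /andP[/eqP cz]; case oz: (owner M z) => [//|c] _.
  have [cn Dz [a at_ ua]] := oP _ _ zn oz.
  exists a; first exact: ltn_trans at_ tk.
  rewrite at_ ua; split=> // [i i_n ci _|]; last by left; exists z.
  by apply: le_trans (D_tri i_n zn cn) _; rewrite addrC lerD // diam.
exists t => //; rewrite ltnn; split=> // [i i_n ci _|].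
  by apply: le_trans (diam _ _ i_n pn ci erefl) _; rewrite lerDr.
right=> i i_n ci; apply/eqP; rewrite -leqn0 leqNgt; apply: contra none => oi.
by apply/hasP; exists i; rewrite ?mem_iota ?ci ?eqxx.
Qed.

Lemma cover_run_good t :
  (t <= k)%N ->
  exists gm ga J, [/\ forall i, (gm i <= k + k)%N, forall i, (ga i <= k)%N
    & cover_good t (cover_run gm ga t) J].
Proof.
elim: t => [|t IHt] tk.
  exists (fun=> 0%N), (fun=> 0%N), [::]; split=> //; split=> //=.
  - by rewrite big_nil.
  - by left.
have [gm [ga [J [gmk gak good]]]] := IHt (ltnW tk).
have [m [a [J' [mk ak good']]]] := cover_step_good (cover_run_sound gm ga t) good tk.
exists (fun i => if i == t then m else gm i), (fun i => if i == t then a else ga i), J'.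
split=> [i|i|]; [by case: eqP|by case: eqP => // _; exact: ltnW|].
rewrite /= !eqxx (@eq_cover_run _ _ gm ga) // => i it; by rewrite ltn_eqF.
Qed.

Lemma cover_run_complete :
  exists gm ga, let M := cover_run gm ga k in
  [/\ forall i, (gm i <= k + k)%N, forall i, (ga i <= k)%N,
      forall i, (i < n)%N -> owner M i <> 0%N,
      forall i c, (i < n)%N -> owner M i = c.+1 ->
        (l <= count (fun j => owner M j == c.+1) (iota 0 n))%N
    & spent M <= 2 * \sum_(j <- J0) r j + k%:R * u].
Proof.
have [gm [ga [J [gmk gak [Ju Jsub Jcov Jtot Jsize Jprog]]]]] := cover_run_good (leqnn k).
exists gm, ga; split=> //.
(* After [k] productive steps, [J] has [k] elements inside [J0], which has at most [k]; so [J]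
   contains every cluster. *)
- move=> i i_n; case: Jprog => [Jk|]; last exact.
  apply: Jcov => //; have [|_ ->] := uniq_min_size Ju Jsub; last exact: cl_in.
  by rewrite Jk.
apply: le_trans Jtot _.
(* Rounding costs one [u] for each element of [J], at most $ku$ altogether. *)
rewrite big_split /= -mulr_sumr lerD //; last first.
  rewrite big_const_seq count_predT iter_addr_0 -[u *+ _]mulr_natl ler_wpM2r // ler_nat.
  exact: leq_trans (uniq_leq_size Ju Jsub) J0_size.
rewrite ler_wpM2l // (perm_big [seq j <- J0 | j \in J]) /=; last first.
  apply: uniq_perm => //; first exact: filter_uniq.
  by move=> j; rewrite mem_filter; case: (boolP (j \in J)) => // /Jsub ->.
rewrite big_filter big_mkcond /= big_seq [leRHS]big_seq; apply: ler_sum => j jJ.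
by case: ifP => // _; exact: r_ge0.
Qed.

End Completeness.
End Covering.

(** * Correctness of the search *)

(** Every combination of choices is thus among the enumerated guesses. Induction splits off the
    lowest digit. *)
Lemma digits_exist (b L : nat) (g : nat -> nat) :
  (forall i, (g i < b)%N) ->
  exists2 G, (G < b ^ L)%N & forall i, (i < L)%N -> ((G %/ b ^ i) %% b)%N = g i.
Proof.
elim: L g => [|L IHL] g gb; first by exists 0%N.
have [|G GL Gd] := IHL (fun i => g i.+1); first by move=> i; exact: gb.
have b0 : (0 < b)%N by exact: leq_ltn_trans (gb 0%N).
exists (G * b + g 0)%N.
  rewrite expnSr; apply: (@leq_trans (G.+1 * b)); last by rewrite leq_mul2r GL orbT.
  by rewrite mulSn addnC ltn_add2r.
case=> [|i] iL; first by rewrite expn0 divn1 modnMDl modn_small.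
by rewrite expnS divnMA divnMDl // (divn_small (gb 0%N)) addn0 Gd.
Qed.

Section Search.
Variables (R : realType) (D : nat -> nat -> R) (n k l : nat).
Hypothesis D_ge0 : forall x y, 0 <= D x y.
Implicit Types (s : state R) (M : cover_state R).

Definition owned M (c : nat) : nat := count (fun j => owner M j == c.+1) (iota 0 n).

Definition valid M : bool :=
  all (fun i => (0 < owner M i)%N && ((0 < owned M i)%N ==> (l <= owned M i)%N))
    (iota 0 n).

Definition digit (G i : nat) : nat := ((G %/ (k + k + 1) ^ i) %% (k + k + 1))%N.

Definition guess_run (x y G : nat) : cover_state R :=
  cover_run D n (D x y / k%:R) (digit G) (fun i => digit G (i + k)) k.

Record constants s : Prop := Constants {
  const_n : nmem s 0 0 = n;
  const_k : nmem s 0 1 = k;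
  const_l : nmem s 0 2 = l;
  const_guesses : nmem s 3 0 = ((k + k + 1) ^ (k + k))%N;
  const_rk : rmem s 5 0 = k%:R
}.

Lemma sem_ball_steps s u :
    nmem s 0 0 = n -> nmem s 0 1 = k ->
    (forall m, (m <= k + k)%N -> rmem s 1 m = m%:R * u) -> 0 <= u ->
    (forall t, (t < k)%N -> (nmem s 7 t <= k + k)%N) ->
    agrees n 0 s (cover_init R) ->
  agrees n k (sem D ball_steps s)
    (cover_run D n u (nmem s 7) (fun t => nmem s 7 (t + k)%N) k).
Proof.
move=> sn sk um u0 dk ag.
pose Q t s' := agrees n t s'
  (cover_run D n u (nmem s 7) (fun t => nmem s 7 (t + k)%N) t).
suff : Q (neval s kN) (sem D ball_steps s) by rewrite /Q /= sk.
apply: sem_forP => // t s' tk vt nt rt Qt.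
rewrite /= sk in tk.
have := @sem_ball_step _ D s' n k u t.
rewrite (nt 7%N) // => /(_ _ _ _ vt _ _ _ Qt); apply; rewrite ?nt //.
- by move=> m mk; rewrite rt // um.
- exact: dk.
- exact: (used_le (cover_run_sound _ _ u0 _ _ _)).
Qed.

Lemma sem_attempt s x y :
    constants s -> (nmem s 22 0 < (k + k + 1) ^ (k + k))%N ->
    (forall m, (m <= k + k)%N -> rmem s 1 m = m%:R * (D x y / k%:R)) ->
  let M := guess_run x y (nmem s 22 0) in
  let s' := sem D attempt s in
  if valid M && ~~ ((0 < nmem s 14 0)%N && (rmem s 4 0 <= spent M))
  then [/\ nmem s' 14 0 = 1%N, rmem s' 4 0 = spent M
         & forall i, (i < n)%N -> nmem s' 1 i = (owner M i).-1 /\ nmem s' 2 i = owned M i]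
  else [/\ nmem s' 14 0 = nmem s 14 0, rmem s' 4 0 = rmem s 4 0,
           nmem s' 1 = nmem s 1 & nmem s' 2 = nmem s 2].
Proof.
move=> [sn sk sl sg _] GH um M s'; rewrite {}/s' /attempt.
set G := nmem s 22 0 in GH M *.
have u0 : 0 <= D x y / k%:R by rewrite divr_ge0.
have dec t : (t < k + k)%N -> nmem (sem D decode s) 7 t = digit G t.
  by move=> tk; rewrite sem_decode ?sg ?sk.
rewrite semE; have n1 a : a \notin nwrites decode ->
  nmem (sem D decode s) a = nmem s a by move=> ha; rewrite nmem_sem.
have r1 a : rmem (sem D decode s) a = rmem s a by rewrite rmem_sem.
move: (sem D decode s) dec n1 r1 => s1 dec n1 r1.
rewrite semE; have [] := sem_init_balls D s1.
have n2 a : a \notin nwrites init_balls ->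
  nmem (sem D init_balls s1) a = nmem s1 a by move=> ha; rewrite nmem_sem.
have r2 a : a \notin rwrites init_balls ->
  rmem (sem D init_balls s1) a = rmem s1 a by move=> ha; rewrite rmem_sem.
move: (sem D init_balls s1) n2 r2 => s2 n2 r2 i5 i2 i3.
rewrite n1 // sn in i5 i2.
rewrite semE; have : agrees n k (sem D ball_steps s2) M.
  have -> : M = cover_run D n (D x y / k%:R) (nmem s2 7) (fun t => nmem s2 7 (t + k)%N) k.
    apply: eq_cover_run => i ik; rewrite n2 // dec //; lia.
  apply: sem_ball_steps => //.
  - by rewrite n2 // n1.
  - by rewrite n2 // n1.
  - by move=> m mk; rewrite r2 // r1 um.
  - move=> t tk; rewrite n2 // dec; last by lia.
    by rewrite -ltnS /digit -[(k + k).+1]addn1 ltn_mod; lia.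
have n3 a : a \notin nwrites ball_steps ->
  nmem (sem D ball_steps s2) a = nmem s2 a by move=> ha; rewrite nmem_sem.
have r3 a : a \notin rwrites ball_steps ->
  rmem (sem D ball_steps s2) a = rmem s2 a by move=> ha; rewrite rmem_sem.
move: (sem D ball_steps s2) n3 r3 => s3 n3 r3 [o3 _ _ t3].
rewrite semE; have [] := sem_check D s3.
have n4 a : a \notin nwrites check ->
  nmem (sem D check s3) a = nmem s3 a by move=> ha; rewrite nmem_sem.
have r4 a : rmem (sem D check s3) a = rmem s3 a by rewrite rmem_sem.
move: (sem D check s3) n4 r4 => s4 n4 r4.
have n03 : nmem s3 0 = nmem s 0 by rewrite n3 // n2 // n1.
rewrite n03 sn sl.
have ow c : count (fun j => nmem s3 5 j == c.+1) (iota 0 n) = owned M c.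
  by apply: eq_in_count => j; rewrite mem_iota /= => jn; rewrite o3.
move=> c4 v4.
have {}v4 : (0 < nmem s4 13 0)%N = valid M.
  rewrite v4; apply: eq_in_all => i; rewrite mem_iota /= => i_n.
  by rewrite o3 // ow.
have := sem_save D s4; rewrite v4.
have -> : nmem s4 14 = nmem s 14 by rewrite n4 // n3 // n2 // n1.
have -> : rmem s4 4 0 = rmem s 4 0 by rewrite r4 r3 // r2 // r1.
have -> : rmem s4 3 0 = spent M by rewrite r4.
rewrite n4 // n03 sn; case: (_ && _) => [[-> -> sv]|->].
  split=> // i i_n; have [-> ->] := sv _ i_n.
  by rewrite n4 // o3 // c4 // ow.
by rewrite r4 r3 // r2 // r1 !n4 // !n3 // !n2 // !n1.
Qed.

(** The search is analysed for an abstract property of the saved arrays and total, which keeps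
    instances and solutions out of this section. *)
Variable certified : (nat -> nat) -> (nat -> nat) -> R -> Prop.
Hypothesis valid_certified : forall x y G f g,
  valid (guess_run x y G) ->
  (forall i, (i < n)%N -> f i = (owner (guess_run x y G) i).-1 /\
                          g i = owned (guess_run x y G) i) ->
  certified f g (spent (guess_run x y G)).

Definition holds_certificate s : Prop :=
  (0 < nmem s 14 0)%N -> certified (nmem s 1) (nmem s 2) (rmem s 4 0).

Definition reached (beta : R) s : Prop := (0 < nmem s 14 0)%N /\ rmem s 4 0 <= beta.

Variables (beta : R) (x0 y0 G0 : nat).
Hypotheses (G0_lt : (G0 < (k + k + 1) ^ (k + k))%N)
  (good_valid : valid (guess_run x0 y0 G0))
  (good_spent : spent (guess_run x0 y0 G0) <= beta).

(** A saved total is replaced only by a smaller one, so a total at most [beta], once reached, is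
    never lost. *)
Lemma attempt_invariant s x y :
    constants s -> (nmem s 22 0 < (k + k + 1) ^ (k + k))%N ->
    (forall m, (m <= k + k)%N -> rmem s 1 m = m%:R * (D x y / k%:R)) ->
    holds_certificate s ->
  [/\ holds_certificate (sem D attempt s),
      reached beta s -> reached beta (sem D attempt s)
    & x = x0 -> y = y0 -> nmem s 22 0 = G0 -> reached beta (sem D attempt s)].
Proof.
move=> cs GH um hs; have := sem_attempt cs GH um; rewrite /holds_certificate /reached /=.
set M := guess_run _ _ _.
case: ifP => [/andP[vM bM] [-> -> sv]|/negbT + [-> -> -> ->]].
  split=> [_|[found best]|xx yy GG]; first exact: valid_certified vM sv.
    split=> //; move: bM; rewrite found /= -ltNge => /ltW bM.
    exact: le_trans bM best.
  by split=> //; rewrite /M xx yy GG.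
(* The good guess is valid, so it can be rejected only if the stored total is already no larger. *)
move=> nb; split=> // xx yy GG; move: nb; rewrite /M xx yy GG good_valid /= negbK.
by case/andP=> -> bM; split=> //; exact: le_trans bM good_spent.
Qed.

Lemma constants_frame s s' :
  nmem s' 0 = nmem s 0 -> nmem s' 3 = nmem s 3 -> rmem s' 5 = rmem s 5 ->
  constants s -> constants s'.
Proof. by move=> e0 e3 e5 [? ? ? ? ?]; split; rewrite ?e0 ?e3 ?e5. Qed.

Lemma guesses_invariant s x y :
    constants s ->
    (forall m, (m <= k + k)%N -> rmem s 1 m = m%:R * (D x y / k%:R)) ->
    holds_certificate s ->
  let s' := sem D (SFor 22 (nvar 3) attempt) s in
  [/\ holds_certificate s', reached beta s -> reached beta s'
    & x = x0 -> y = y0 -> reached beta s'].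
Proof.
move=> cs um hs s'.
pose Q j s1 := [/\ holds_certificate s1, reached beta s -> reached beta s1
    & x = x0 -> y = y0 -> (G0 < j)%N -> reached beta s1].
have [h1 h2 h3] : Q (neval s (nvar 3)) s'.
  apply: sem_forP => [|j s1 jH vj nj rj [q1 q2 q3]]; first by split.
  rewrite /= (const_guesses cs) in jH.
  have [||||a1 a2 a3] := @attempt_invariant s1 x y => //.
  - by apply: constants_frame cs; rewrite ?nj ?rj.
  - by rewrite vj.
  - by move=> m mk; rewrite rj // um.
  split=> //; first by move=> /q2; exact: a2.
  move=> xx yy; rewrite ltnS leq_eqVlt => /orP[/eqP Gj|Gj]; first by apply: a3; rewrite ?vj.
  exact/a2/q3.
split=> // xx yy; apply: h3 => //; by rewrite /= (const_guesses cs).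
Qed.

Lemma search_certified s :
    constants s -> nmem s 14 0 = 0%N -> (x0 < n)%N -> (y0 < n)%N ->
  exists2 b, b <= beta &
    certified (nmem (sem D search s) 1) (nmem (sem D search s) 2) b.
Proof.
move=> cs nf x0n y0n.
pose Q j s1 := holds_certificate s1 /\ ((x0 < j)%N -> reached beta s1).
have [h1 h2] : Q (neval s nN) (sem D search s).
  apply: sem_forP => [|x s1 xn vx nx rx [q1 q2]].
    by split=> //; rewrite /holds_certificate /= /update /= nf.
  have cs1 : constants s1 by apply: constants_frame cs; rewrite ?nx ?rx.
  set L := SFor 21 _ _.
  pose Q1 j s2 := [/\ holds_certificate s2, reached beta s1 -> reached beta s2
    & x = x0 -> (y0 < j)%N -> reached beta s2].
  have [a1 a2 a3] : Q1 (neval s1 nN) (sem D L s1).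
    apply: sem_forP => [|y s2 yn vy ny ry [p1 p2 p3]]; first by split.
    rewrite semE; set s3 := sem D unit_multiples s2.
    have [|||b1 b2 b3] := @guesses_invariant s3 x y.
    - by apply: constants_frame cs1; rewrite ?nmem_sem ?rmem_sem ?ny ?ry.
    - move=> m mk; have c2 : constants s2 by apply: constants_frame cs1; rewrite ?ny ?ry.
      rewrite /s3 sem_unit_multiples ?(const_k c2) // vy (const_rk c2).
      by rewrite ny // vx.
    - by rewrite /holds_certificate /s3 !nmem_sem ?rmem_sem.
    have r23 : reached beta s2 -> reached beta s3.
      by rewrite /reached /s3 !nmem_sem ?rmem_sem.
    split=> //; first by move=> /p2/r23; exact: b2.
    move=> xx; rewrite ltnS leq_eqVlt => /orP[/eqP yj|yj]; first by apply: b3.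
    exact/b2/r23/p3.
  split=> //; rewrite ltnS leq_eqVlt => /orP[/eqP xj|xj].
    by apply: a3; rewrite //= (const_n cs1).
  exact/a2/q2.
have [|found best] := h2; first by rewrite /= (const_n cs).
by exists (rmem (sem D search s) 4 0) => //; exact: h1.
Qed.

End Search.

(** * From memory cells to solutions *)

Lemma card_count_rank (T : finType) (a : pred nat) :
  #|[set p : T | a (enum_rank p)]| = count a (iota 0 #|T|).
Proof.
rewrite -sum1_card -sum1_count -[in RHS](subn0 #|T|) -/(index_iota 0 #|T|) big_mkord.
rewrite (reindex (@enum_rank T)) /=; last exact/onW_bij/enum_rank_bij.
by apply: eq_bigl => p; rewrite inE.
Qed.

Section Instance.
Variables (R : realType) (I : instance R).
Let P := point I.
Let n := #|P|.
Let D := dist_query I.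

Definition nth_point (p0 : P) (i : nat) : P :=
  if insub i is Some j then enum_val (j : 'I_#|P|) else p0.

Lemma nth_pointK p0 i : (i < n)%N -> enum_rank (nth_point p0 i) = i :> nat.
Proof. by move=> i_n; rewrite /nth_point insubT /= enum_valK. Qed.

Lemma rankK p0 (p : P) : nth_point p0 (enum_rank p) = p.
Proof. by apply/enum_rank_inj/val_inj; rewrite /= nth_pointK. Qed.

Lemma dist_query_rank (p q : P) : D (enum_rank p) (enum_rank q) = dist p q.
Proof. by rewrite /D /dist_query !valK !enum_rankK. Qed.

Lemma dist_query_ge0 x y : 0 <= D x y.
Proof.
rewrite /D /dist_query; case: insub => [a|//]; case: insub => [b|//].
exact: (metric_ge0 (dist_metric I)).
Qed.

Lemma dist_query_sym x y : D x y = D y x.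
Proof.
rewrite /D /dist_query; case: insub => [a|]; case: insub => [b|] //.
exact: (metric_sym (dist_metric I)).
Qed.

Lemma dist_query_nth p0 x y : (x < n)%N -> (y < n)%N ->
  D x y = dist (nth_point p0 x) (nth_point p0 y).
Proof. by move=> xn yn; rewrite -dist_query_rank !nth_pointK. Qed.

(** The range conditions are essential: queries outside the range return 0, so an outside index
    would be at distance 0 from everything. *)
Lemma dist_query_triangle x y z : (x < n)%N -> (y < n)%N -> (z < n)%N ->
  D x z <= D x y + D y z.
Proof.
move=> xn yn zn; have p0 : P := enum_val (Ordinal xn).
rewrite !(dist_query_nth p0) //; exact: (metric_triangle (dist_metric I)).
Qed.

Lemma radius_ge0 (s : candidate P) c : 0 <= radius s c.
Proof. exact: bigmax_ge_id. Qed.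

Lemma cost_ge0 (s : candidate P) : 0 <= cost s.
Proof. by apply: sumr_ge0 => c _; exact: radius_ge0. Qed.

Lemma dist_le_radius (s : candidate P) p : dist p (assign s p) <= radius s (assign s p).
Proof.
rewrite /radius; apply: (le_bigmax_cond 0 (fun q => dist q (assign s p))).
by rewrite inE.
Qed.

Definition certificate (f g : nat -> nat) (b : R) : Prop :=
  exists x : candidate P,
    [/\ forall p : P, f (enum_rank p) = enum_rank (assign x p) :> nat /\
          (p \in centers x) = (g (enum_rank p) != 0%N),
        feasible x & cost x <= b].

(** The centers are the points that own something. They lie among the [k] used centers, and each
    cluster lies within its ball, so [spent] bounds the cost. *)
Lemma sound_certificate (M : cover_state R) f g :
    cover_sound D n (budget I) M -> valid n (lower_bound I) M ->
    (forall i, (i < n)%N -> f i = (owner M i).-1 /\ g i = owned n M i) ->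
  certificate f g (spent M).
Proof.
move=> snd /allP val fg.
pose x : candidate P := Candidate [set c : P | (0 < owned n M (enum_rank c))%N]
  (fun p => nth_point p (owner M (enum_rank p)).-1).
have own (p : P) : owner M (enum_rank p) = (enum_rank (assign x p)).+1.
  have := val (enum_rank p); rewrite mem_iota /= ltn_ord => /(_ isT)/andP[o0 _].
  case oc : (owner M (enum_rank p)) o0 => [//|c] _.
  have [cn _ _] := ownerP snd (ltn_ord _) oc.
  by rewrite /= nth_pointK.
have cl (c : P) : #|cluster x c| = owned n M (enum_rank c).
  rewrite /owned -card_count_rank; apply: eq_card => p; rewrite !inE own eqSS.
  by rewrite (inj_eq val_inj) (inj_eq enum_rank_inj).
have ctr p : assign x p \in centers x.
  by rewrite inE -cl card_gt0; apply/set0Pn; exists p; rewrite inE.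
exists x; split.
- move=> p; have [-> ->] := fg _ (ltn_ord (enum_rank p)).
  by rewrite own inE lt0n.
- split=> //; last first.
    move=> c; rewrite inE cl => oc; have := val (enum_rank c).
    by rewrite mem_iota /= ltn_ord oc => /(_ isT)/andP[].
  rewrite cardE -(size_map (fun c => enum_rank c : nat)).
  rewrite -(size_iota 0 (budget I)) -(size_map (used M) (iota _ _)); apply: uniq_leq_size.
    by rewrite map_inj_uniq ?enum_uniq // => a b /val_inj/enum_rank_inj.
  move=> _ /mapP[c + ->]; rewrite mem_enum inE -cl card_gt0 => /set0Pn[p].
  rewrite inE => /eqP pc; have [_ _ [j jk uj]] := ownerP snd (ltn_ord _) (own p).
  by rewrite -pc; apply/mapP; exists j; rewrite ?mem_iota.
- apply: le_trans (spent_ge snd).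
  rewrite (reindex (@enum_rank P)) /=; last exact/onW_bij/enum_rank_bij.
  rewrite /cost big_mkcond /=; apply: ler_sum => c _.
  case: ifP => _; last exact: (ball_ge0 snd).
  apply: bigmax_le => [|p]; first exact: (ball_ge0 snd).
  rewrite inE => /eqP pc; have [_ + _] := ownerP snd (ltn_ord _) (own p).
  by rewrite dist_query_rank pc.
Qed.

(** A radius is attained as a distance between points, so trying all pairs finds [rmax]; as one term
    of the cost, it is at most the cost. *)
Lemma largest_radius (s : candidate P) (p0 : P) :
  feasible s ->
  exists x y : P, (forall c, c \in centers s -> radius s c <= dist x y) /\
    dist x y <= cost s.
Proof.
move=> [_ ctr _].
have [c cc cmax] := arg_maxP (radius s) (ctr p0).
suff [x [y xy]] : exists x y : P, dist x y = radius s c.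
  exists x, y; rewrite xy; split=> [c' c'c|]; first exact: cmax.
  rewrite /cost (bigD1 c) //= lerDl.
  by apply: sumr_ge0 => c' _; exact: radius_ge0.
have [e|[p pc]] := set_0Vmem (cluster s c).
  (* The default radius 0 of an empty cluster is also a distance, from [c] to itself. *)
  exists c, c; rewrite /radius e big_set0; exact/(metric_eq0 (dist_metric I)).
have [q _ rq] := eq_bigmax p (mem (cluster s c)) (fun q => dist q c) pc
  (fun i _ => metric_ge0 (dist_metric I) i c).
by exists q, c; rewrite -rq.
Qed.

Lemma optimal_guess (opt : candidate P) (p0 : P) :
  feasible opt ->
  exists x y G, [/\ (x < n)%N, (y < n)%N,
    (G < (budget I + budget I + 1) ^ (budget I + budget I))%N,
    valid n (lower_bound I) (guess_run D n (budget I) x y G)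
    & spent (guess_run D n (budget I) x y G) <= 3 * cost opt].
Proof.
move=> fe; have [x [y [rmax xyc]]] := largest_radius p0 fe.
have [bud ctr siz] := fe.
set k := budget I in bud *.
(* The center assigned to [p0] makes the budget positive, so dividing by it is meaningful. *)
have k0 : (0 < k)%N by apply: leq_trans bud; rewrite card_gt0; apply/set0Pn; exists (assign opt p0).
pose u := D (enum_rank x) (enum_rank y) / k%:R.
have ku : k%:R * u = dist x y.
  by rewrite /u mulrC mulfVK ?dist_query_rank // pnatr_eq0 -lt0n.
have u0 : 0 <= u by rewrite divr_ge0 // dist_query_ge0.
pose cl i : nat := enum_rank (assign opt (nth_point p0 i)).
pose r j := radius opt (nth_point p0 j).
pose J0 : seq nat := [seq (enum_rank c : nat) | c <- enum (centers opt)].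
have [||||||||||gm [ga [gmk gak cov big tot]]] :=
    @cover_run_complete R D n u u0 k (lower_bound I) cl r J0.
- exact: dist_query_sym.
- exact: dist_query_triangle.
- by rewrite map_inj_uniq ?enum_uniq // => a b /val_inj/enum_rank_inj.
- by rewrite size_map -cardE.
- by move=> _ /mapP[c _ ->]; exact: ltn_ord.
- by move=> i _; apply/mapP; exists (assign opt (nth_point p0 i)); rewrite ?mem_enum.
- move=> i i_n; rewrite /cl /r rankK -{1}(nth_pointK p0 i_n) dist_query_rank.
  exact: dist_le_radius.
- move=> _ /mapP[c + ->]; rewrite mem_enum => cc; apply: leq_trans (siz c cc) _.
  rewrite -card_count_rank eq_leq //; apply: eq_card => p; rewrite !inE /cl rankK.
  by rewrite (inj_eq val_inj) (inj_eq enum_rank_inj).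
- by move=> j _; exact: radius_ge0.
- by move=> _ /mapP[c + ->]; rewrite mem_enum /r rankK ku => /rmax.
(* The low [k] digits encode the growth, the high [k] digits the choice of balls. *)
pose g i := if (i < k)%N then gm i else ga (i - k)%N.
have [|G Gk Gd] := @digits_exist (k + k + 1) (k + k) g.
  by move=> i; rewrite /g addn1 ltnS; case: ifP => // _; apply: leq_trans (gak _) (leq_addr _ _).
have runE : guess_run D n k (enum_rank x) (enum_rank y) G = cover_run D n u gm ga k.
  apply: eq_cover_run => i ik; rewrite /digit Gd /g ?ik //; try lia.
  by rewrite ltnNge leq_addl /= addnK.
exists (enum_rank x), (enum_rank y), G; split=> //.
  rewrite runE; apply/allP => i; rewrite mem_iota /= => i_n.
  rewrite lt0n; apply/andP; split; first exact/eqP/cov.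
  apply/implyP; rewrite /owned -has_count => /hasP[j]; rewrite mem_iota /= => jn /eqP oj.
  exact: big jn oj.
rewrite runE; apply: le_trans tot _; rewrite ku big_map.
have -> : \sum_(c <- enum (centers opt)) r (enum_rank c) = cost opt.
  by rewrite big_enum /=; apply: eq_bigr => c _; rewrite /r rankK.
(* Twice the optimum from the diameters, plus $ku = $ [rmax], which is at most the optimum. *)
by move: xyc; lra.
Qed.

(** * The whole program on an instance: output and running time *)

Lemma setup_constants :
  constants #|point I| (budget I) (lower_bound I) (sem D setup (input_state I)).
Proof.
have n0 : nmem (sem D setup (input_state I)) 0 = nmem (input_state I) 0 by rewrite nmem_sem.
split; rewrite ?n0 // /setup semE.
  by rewrite nmem_sem // sem_count_guesses.
by rewrite sem_real_budget nmem_sem.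
Qed.

Lemma search_approximates (opt : candidate P) :
  feasible opt ->
  exists x : candidate P,
    [/\ outputs (sem D search (sem D setup (input_state I))) x, feasible x
      & cost x <= 3 * cost opt].
Proof.
move=> fe; case: (pickP (mem [set: P])) => [p0 _|noP]; last first.
  (* Without points the output condition is vacuous and [opt] itself serves. *)
  exists opt; split=> //; first by move=> p; have := noP p; rewrite !inE.
  by rewrite ler_peMl ?cost_ge0 // ler1n.
have [x0 [y0 [G0 [x0n y0n G0k vG sG]]]] := optimal_guess p0 fe.
have [||b bb [x [ox fx cx]]] := search_certified dist_query_ge0 _ G0k vG sG
    setup_constants _ x0n y0n (certified := certificate).
- move=> x y G f g vM fg; apply: sound_certificate vM fg.
  by apply: cover_run_sound; rewrite divr_ge0 // dist_query_ge0.
- by rewrite nmem_sem.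
by exists x; split=> //; exact: le_trans cx bb.
Qed.

(** Exceeds every loop bound that depends on $k$ only; the slack also makes its product with $|P|+1$
    exceed $|P|+1$. *)
Definition loop_limit (k : nat) : nat := ((k + k + 1) ^ (k + k) + (k + k) + 3)%N.

Lemma algorithm_exec :
  exists2 t, (t <= (weight setup + weight search) *
      (loop_limit (budget I) * #|point I|.+1) ^ maxn (depth setup) (depth search))%N
    & exec D (Seq (compile setup) (compile search)) (input_state I) t
        (sem D search (sem D setup (input_state I))).
Proof.
set k := budget I; set X := (loop_limit k * #|point I|.+1)%N.
have X0 : (0 < X)%N by rewrite muln_gt0 /loop_limit addnS.
have lim e : (e < loop_limit k)%N -> (e < X)%N.
  by move=> h; apply: leq_trans h _; rewrite leq_pmulr.
have nX1 : (#|point I| + 1 < X)%N by rewrite /X /loop_limit; nia.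
have nX : (#|point I| < X)%N by apply: leq_ltn_trans nX1; rewrite leq_addr.
have [kX k2X bX gX] : [/\ (k < X)%N, (k + k < X)%N, (k + k + 1 < X)%N
    & ((k + k + 1) ^ (k + k) < X)%N] by split; apply: lim; rewrite /loop_limit; lia.
have [cn ck cl cg _] := setup_constants.
have [|t1 le_t1 ex1] := @exec_sem R D setup (input_state I) (input_state I) X isT isT
    (fun _ _ => erefl) _ X0.
  by rewrite /= -/k kX k2X bX.
have [|t2 le_t2 ex2] := @exec_sem R D search _ (sem D setup (input_state I)) X isT isT
    (fun _ _ => erefl) _ X0.
  by rewrite /= cn ck cg -/k nX nX1 kX k2X gX.
exists (t1 + t2)%N; last exact: ExecSeq ex1 ex2.
rewrite mulnDl; apply: leq_add.
  by apply: leq_trans le_t1 _; rewrite leq_weight_depth // leq_maxl.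
by apply: leq_trans le_t2 _; rewrite leq_weight_depth // leq_maxr.
Qed.

End Instance.

Theorem theorem14 (R : realType) :
  exists (f : nat -> R -> nat) (q : {poly nat}),
    forall eps : R, 0 < eps ->
      exists A : program,
        forall I : instance R,
          approximates_within I A (3 + eps)
            (f (budget I) eps * q.[#|point I|])%N.
Proof.
pose d := maxn (depth setup) (depth search).
(* The loop limit is a function of $k$ times $|P|+1$, so its power splits into an FPT factor and the
   polynomial $(X+1)^d$ at $|P|$. *)
exists (fun k _ => (weight setup + weight search) * loop_limit k ^ d)%N, (('X + 1) ^+ d).
move=> eps eps0; exists (Seq (compile setup) (compile search)) => I.
have [t le_t ex] := algorithm_exec I.
exists t, (sem (dist_query I) search (sem (dist_query I) setup (input_state I))).
split=> //.
  rewrite horner_exp hornerD hornerX hornerC natrXE natrDE addn1.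
  by apply: leq_trans le_t _; rewrite -/d expnMn mulnA.
move=> opt [fe _]; have [x [ox fx cx]] := search_approximates fe.
exists x; split=> //; apply: le_trans cx _.
by rewrite ler_wpM2r ?cost_ge0 // lerDl ltW.
Qed.
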